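(* Let $\beta_0$ be the true parameter and let $\mathcal J=\{g_i(\beta_0)\}_{i=1}^n$. Suppose that (reflection invariance) $G(\beta_0)\overset{d}{=}D_rG(\beta_0)$, where $r=(r_1,\dots,r_n)'$ is a vector of independent Rademacher variables ($\Pr(r_i=1)=\Pr(r_i=-1)=1/2$) independent of $G(\beta_0)$, and that with probability one for all sufficiently large $n$: (a) $\operatorname{rank}P(\beta_0)=k$, and (b) $\sigma_n^2(\beta_0)>1/C$ for some finite constant $C>0$. If $k\to\infty$ as $n\to\infty$, then, conditionally on $\mathcal J$ and for almost every sequence of realizations of $\mathcal J$, $$(k\sigma_n^2(\beta_0))^{-1/2}\big(\mathrm{AR}_r(\beta_0)-k\big)\to_d N(0,1),$$ and consequently (unconditionally) $(k\sigma_n^2(\beta_0))^{-1/2}\big(\mathrm{AR}(\beta_0)-k\big)\to_d N(0,1)$.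
   Context: GMM setting (a triangular array in $n$ with $k=k_n$): independent observations $W_1,\dots,W_n$, parameter $\beta\in\mathbb R^p$, moment functions $g_i(\beta)=(g_1(W_i,\beta),\dots,g_k(W_i,\beta))'$ with $k\ge p$ and $E[g_i(\beta_0)]=0$. $G(\beta)$ is the $n\times k$ matrix with rows $g_i(\beta)'$, $P(\beta)=G(\beta)(G(\beta)'G(\beta))^{-1}G(\beta)'$ with entries $P_{ij}(\beta)$, $\iota$ is the $n$-vector of ones, and $D_r$ is the diagonal matrix with diagonal $r$. The Anderson–Rubin statistic is $\mathrm{AR}(\beta)=\iota'P(\beta)\iota$, its Rademacher analogue is $\mathrm{AR}_r(\beta_0)=r'P(\beta_0)r$, and $\sigma_n^2(\beta_0)=\frac{2}{k}\sum_{i\neq j}P_{ij}(\beta_0)^2$. *)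

(* Defs.v *)
From HB Require Import structures.
From mathcomp Require Import all_boot all_order all_algebra.
From mathcomp Require Import all_classical all_reals all_analysis.
Set Implicit Arguments. Unset Strict Implicit. Unset Printing Implicit Defensive.
Import Order.TTheory GRing.Theory Num.Theory numFieldNormedType.Exports.
Local Open Scope classical_set_scope.
Local Open Scope ring_scope.

Section GMM_AR.
Variable R : realType.

Definition sgn (b : bool) : R := if b then 1 else -1.

Definition projP n k (G : 'M[R]_(n, k)) : 'M[R]_n :=
  G *m invmx (G^T *m G) *m G^T.

Definition quadP n k (G : 'M[R]_(n, k)) (v : 'I_n -> R) : R :=
  \sum_(i < n) \sum_(j < n) v i * projP G i j * v j.

Definition ARstat n k (G : 'M[R]_(n, k)) : R := quadP G (fun _ => 1).

Definition ARr n k (G : 'M[R]_(n, k)) (s : {ffun 'I_n -> bool}) : R :=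
  quadP G (fun i => sgn (s i)).

Definition sigma2 n k (G : 'M[R]_(n, k)) : R :=
  2 / k%:R * \sum_(i < n) \sum_(j < n | i != j) projP G i j ^+ 2.

Definition normalize n k (G : 'M[R]_(n, k)) (x : R) : R :=
  (Num.sqrt (k%:R * sigma2 G))^-1 * (x - k%:R).

Definition Dmat n (s : {ffun 'I_n -> bool}) : 'M[R]_n :=
  diag_mx (\row_i sgn (s i)).

(* Conditional cdf (given G) of the normalized AR_r statistic, with
   r uniformly distributed on {-1,1}^n, i.e. independent Rademacher
   components independent of G. *)
Definition rad_cdf n k (G : 'M[R]_(n, k)) (x : R) : R :=
  (2 ^+ n)^-1 * \sum_(s : {ffun 'I_n -> bool})
                   (nat_of_bool (normalize G (ARr G s) <= x)%R)%:R.

Definition mx_gen n k : set (set 'M[R]_(n, k)) :=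
  fun A => exists (i : 'I_n) (j : 'I_k) (B : set R),
      measurable B /\ A = (fun M : 'M[R]_(n, k) => M i j) @^-1` B.

Definition mx_measurable n k : set (set 'M[R]_(n, k)) := <<s (@mx_gen n k) >>.

Definition cdf (mu : set R -> \bar R) (x : R) : R := fine (mu `]-oo, x]%classic).

Definition conv_in_dist (F : nat -> R -> R) (mu : set R -> \bar R) : Prop :=
  forall x : R, cdf mu y @[y --> x] --> cdf mu x ->
    F n x @[n --> \oo] --> cdf mu x.

End GMM_AR.

Definition mutually_independent (d : measure_display) (T : measurableType d)
  (R : realType) (P : probability T R) (dX : measure_display)
  (X : measurableType dX) (n : nat) (W : 'I_n -> T -> X) : Prop :=
  forall (S : {set 'I_n}) (A : 'I_n -> set X),
    (forall i, measurable (A i)) ->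
    P (\big[setI/setT]_(i in S) (W i @^-1` A i)) =
      (\prod_(i in S) P (W i @^-1` A i))%E.

(* G(beta_0): the n x k_n matrix with rows g_i(beta_0)' = (g_j(W_i, beta_0))_j *)
Definition Gmat (R : realType) (T X : Type) (kn : nat -> nat)
  (W : forall n, 'I_n -> T -> X) (g : forall n, 'I_(kn n) -> X -> R)
  (n : nat) (w : T) : 'M[R]_(n, kn n) :=
  \matrix_(i < n, j < kn n) g n j (W n i w).

(* Main.v *)
Require Import Defs.
From HB Require Import structures.
From mathcomp Require Import all_boot all_order all_algebra.
From mathcomp Require Import all_classical all_reals all_analysis.
From mathcomp Require Import measurable_realfun ring lra.
Import Order.TTheory GRing.Theory Num.Theory numFieldNormedType.Exports.
Local Open Scope classical_set_scope.
Local Open Scope ring_scope.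
Set Implicit Arguments. Unset Strict Implicit. Unset Printing Implicit Defensive.

(** Under the hypothesis on the rank, [P = projP G] is an orthogonal projection
    of trace [k], so with [v = k sigma2] the standardised statistic is the
    quadratic form [F = \sum_(i != j) P_ij r_i r_j / sqrt v] in Rademacher signs,
    of variance 1.  Stein's method shows that [E (F f(F))] and [E f'(F)] are
    close as soon as [v] is large, for every [f] with continuous bounded [f']:
    flipping the sign [r_i] changes [F] by [4 r_i L_i], [L_i] being half the
    [i]-th discrete gradient, so by the mean value theorem [E (F f(F))] is about
    [E (2 (\sum_i L_i^2) f'(F))]; and [\sum_i L_i^2] has mean 1/2 and variance at
    most [1/v], because off the diagonal [(P - diag P)^2] has the entries
    [P_jl (1 - P_jj - P_ll)], which are dominated by those of [P].  Solving
    Stein's equation for piecewise affine test functions gives the convergence of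
    the conditional distribution functions.  The unconditional statement follows
    by integrating over [G]: since [projP (D_r G) = D_r (projP G) D_r], reflection
    invariance identifies the law of [AR] with the mixture of the conditional laws
    of [AR_r], and dominated convergence applies. *)

(** * Moments of polynomials in independent Rademacher signs *)

Section RademacherMean.
Variables (R : realType) (n : nat).
Local Notation signs := {ffun 'I_n -> bool}.
Implicit Types (X Y : signs -> R) (s : signs).

(** Expectation over the signs as a finite average, so that [rad_cdf] unfolds to the [rmean] of an
    indicator. *)
Definition rmean X : R := (2 ^+ n)^-1 * \sum_(s : signs) X s.

Definition flip (i : 'I_n) s : signs :=
  [ffun j => if j == i then ~~ s j else s j].

Lemma flipK i : involutive (flip i).
Proof.
by move=> s; apply/ffunP => j; rewrite !ffunE; case: eqP => // _; rewrite negbK.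
Qed.

Lemma sgn_flip i s j :
  sgn R (flip i s j) = if j == i then - sgn R (s j) else sgn R (s j).
Proof. by rewrite ffunE /sgn; case: eqP => // _; case: (s j); rewrite ?opprK. Qed.

Lemma sgn_sq (b : bool) : sgn R b * sgn R b = 1.
Proof. by case: b; rewrite /sgn ?mulr1 // mulrNN mulr1. Qed.

Lemma rmean_flip i X : rmean (X \o flip i) = rmean X.
Proof.
congr (_ * _); rewrite [RHS](reindex_inj (inv_inj (flipK i))).
by apply: eq_bigr.
Qed.

Lemma eq_rmean X Y : X =1 Y -> rmean X = rmean Y.
Proof. by move=> XY; congr (_ * _); apply: eq_bigr. Qed.

Lemma rmeanD X Y : rmean (fun s => X s + Y s) = rmean X + rmean Y.
Proof. by rewrite /rmean big_split mulrDr. Qed.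

Lemma rmeanZ (c : R) X : rmean (fun s => c * X s) = c * rmean X.
Proof. by rewrite /rmean -mulr_sumr mulrCA. Qed.

Lemma rmeanB X Y : rmean (fun s => X s - Y s) = rmean X - rmean Y.
Proof. by rewrite /rmean sumrB mulrBr. Qed.

Lemma rmean_sum (I : Type) (r : seq I) (Q : pred I) (X : I -> signs -> R) :
  rmean (fun s => \sum_(i <- r | Q i) X i s) = \sum_(i <- r | Q i) rmean (X i).
Proof. by rewrite /rmean exchange_big /= mulr_sumr. Qed.

Lemma rmean_cst (c : R) : rmean (fun=> c) = c.
Proof.
by rewrite /rmean sumr_const card_ffun card_bool card_ord -[X in _ * X]mulr_natl natrX mulKf//.
Qed.

Lemma ler_rmean X Y : (forall s, X s <= Y s) -> rmean X <= rmean Y.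
Proof.
move=> XY; rewrite ler_wpM2l ?invr_ge0 ?exprn_ge0//.
by apply: ler_sum => s _; exact: XY.
Qed.

Lemma rmean_ge0 X : (forall s, 0 <= X s) -> 0 <= rmean X.
Proof. by move=> X0; rewrite -(rmean_cst 0); exact: ler_rmean. Qed.

(** Flipping one sign preserves the uniform law, so the mean equals its own opposite. *)
Lemma rmean_odd i X : (forall s, X (flip i s) = - X s) -> rmean X = 0.
Proof.
move=> Xi; have := rmean_flip i X; rewrite (eq_rmean (Y := fun s => -1 * X s)).
  by rewrite rmeanZ; lra.
by move=> s /=; rewrite Xi mulN1r.
Qed.

Lemma rmean_sgn2 i j : i != j -> rmean (fun s => sgn R (s i) * sgn R (s j)) = 0.
Proof.
move=> ij; apply: (rmean_odd (i := i)) => s.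
by rewrite !sgn_flip eqxx [j == i]eq_sym (negbTE ij) mulNr.
Qed.

(** Unless the two pairs coincide as sets, some index occurs exactly once and flipping its sign
    makes the product odd; if they coincide, all signs square to 1. *)
Lemma rmean_sgn4 i j l m : i != j -> l != m ->
  rmean (fun s => sgn R (s i) * sgn R (s j) * (sgn R (s l) * sgn R (s m))) =
  ((l, m) == (i, j))%:R + ((l, m) == (j, i))%:R.
Proof.
move=> ij lm; rewrite !xpair_eqE.
have [li|li] := eqVneq l i; have [mi|mi] := eqVneq m i; subst.
- by rewrite eqxx in lm.
- have [mj|mj] := eqVneq m j; subst => /=.
    rewrite (negbTE ij) addr0 -[RHS](rmean_cst 1); apply: eq_rmean => s.
    by rewrite mulrACA !sgn_sq mulr1.
  rewrite andbF addr0 -[RHS](rmean_sgn2 (i := j) (j := m)) 1?eq_sym//.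
  apply: eq_rmean => s.
  by rewrite mulrACA sgn_sq mul1r.
- have [lj|lj] := eqVneq l j; subst => /=.
    rewrite add0r -[RHS](rmean_cst 1); apply: eq_rmean => s.
    by rewrite [X in _ * X]mulrC mulrACA !sgn_sq mulr1.
  rewrite addr0 -[RHS](rmean_sgn2 (i := l) (j := j))//.
  apply: eq_rmean => s.
  by rewrite [X in _ * X]mulrC mulrACA sgn_sq mul1r mulrC.
- rewrite /= andbF addr0; apply: (rmean_odd (i := i)) => s.
  rewrite !sgn_flip eqxx [j == i]eq_sym (negbTE ij) (negbTE li) (negbTE mi).
  by rewrite !mulNr.
Qed.

Section QuadraticForm.
Variable b : 'I_n -> 'I_n -> R.
Hypothesis b_sym : forall i j, b i j = b j i.
Hypothesis b_diag : forall i, b i i = 0.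

Definition qform s := \sum_i \sum_j b i j * (sgn R (s i) * sgn R (s j)).

(** In the expanded square only the pairs equal to [(i, j)] or [(j, i)] survive; by symmetry each
    contributes [b i j ^+ 2], whence the factor 2. *)
Lemma rmean_qform_sq :
  rmean (fun s => qform s ^+ 2) = 2 * \sum_i \sum_j b i j ^+ 2.
Proof.
pose e s (p : 'I_n * 'I_n) := sgn R (s p.1) * sgn R (s p.2).
have qE s : qform s ^+ 2 =
    \sum_p \sum_q b p.1 p.2 * b q.1 q.2 * (e s p * e s q).
  rewrite /qform pair_bigA /= expr2 mulr_suml; apply: eq_bigr => p _.
  by rewrite mulr_sumr; apply: eq_bigr => q _; rewrite mulrACA.
rewrite (eq_rmean qE) rmean_sum pair_bigA /= mulr_sumr; apply: eq_bigr => -[i j] _ /=.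
have [->|ij] := eqVneq i j.
  rewrite b_diag expr0n mulr0 (eq_rmean (Y := fun=> 0)) ?rmean_cst// => s.
  by rewrite big1// => q _; rewrite !mul0r.
rewrite rmean_sum (eq_bigr (fun q => (if q == (i, j) then b i j ^+ 2 else 0) +
   (if q == (j, i) then b i j ^+ 2 else 0))).
  by rewrite big_split /= -!big_mkcond !big_pred1_eq; ring.
move=> -[l m] _ /=; rewrite rmeanZ.
have [->|lm] := eqVneq l m.
  rewrite b_diag mulr0 mul0r !xpair_eqE.
  have mij : (m == i) && (m == j) = false.
    by apply: contraNF ij => /andP[/eqP<- /eqP<-].
  by rewrite [(m == j) && _]andbC mij addr0.
rewrite rmean_sgn4//; case: eqP => [[-> ->]|_]; case: eqP => [[h1 h2]|_].
- by rewrite h1 eqxx in ij.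
- by rewrite !addr0 mulr1 expr2.
- by rewrite h1 h2 !add0r mulr1 [b j i]b_sym expr2.
- by rewrite !addr0 mulr0.
Qed.

End QuadraticForm.

(** Khintchine's inequality for the fourth moment: the square of the linear form is [V] plus a
    centred quadratic form with entries [c i * c j], whose second moment is at most [2 * V ^+ 2]. *)
Lemma rmean_linear_pow4 (c : 'I_n -> R) :
  rmean (fun s => (\sum_j c j * sgn R (s j)) ^+ 4) <= 3 * (\sum_j c j ^+ 2) ^+ 2.
Proof.
pose b i j := if i == j then 0 else c i * c j.
set V := \sum_j c j ^+ 2.
have sqE s : (\sum_j c j * sgn R (s j)) ^+ 2 = V + qform b s.
  rewrite expr2 mulr_suml /V /qform -big_split; apply: eq_bigr => i _ /=.
  rewrite mulr_sumr (bigD1 i)//= [in RHS](bigD1 i)//= /b eqxx mul0r add0r.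
  congr (_ + _); first by rewrite mulrACA sgn_sq mulr1 expr2.
  by apply: eq_bigr => j ji; rewrite eq_sym (negbTE ji) mulrACA.
have b_sym i j : b i j = b j i by rewrite /b eq_sym mulrC.
have b_diag i : b i i = 0 by rewrite /b eqxx.
have q0 : rmean (qform b) = 0.
  rewrite /qform rmean_sum big1// => i _; rewrite rmean_sum big1// => j _.
  rewrite rmeanZ; have [->|ij] := eqVneq i j; first by rewrite b_diag mul0r.
  by rewrite rmean_sgn2// mulr0.
rewrite (eq_rmean (Y := fun s => V ^+ 2 + 2 * V * qform b s + qform b s ^+ 2)); last first.
  by move=> s; rewrite (exprM _ 2 2) sqE; ring.
rewrite !rmeanD rmean_cst rmeanZ q0 rmean_qform_sq// mulr0 addr0.
have : \sum_i \sum_j b i j ^+ 2 <= V ^+ 2.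
  rewrite expr2 {1}/V mulr_suml; apply: ler_sum => i _; rewrite mulr_sumr.
  apply: ler_sum => j _; rewrite /b; case: eqP => _; last by rewrite exprMn.
  by rewrite expr0n /= mulr_ge0 ?sqr_ge0.
lra.
Qed.

End RademacherMean.
Arguments rmean {R n}.
Arguments qform {R n}.

(** * Mean value theorem and a modulus of continuity *)

Section SteinOperator.
Variable R : realType.

Lemma mvt_between (f f' : R -> R) : (forall x : R, is_derive x 1 f (f' x)) ->
  forall x y, exists2 z, f x - f y = f' z * (x - y) & `|z - x| <= `|x - y|.
Proof.
move=> df.
have cf : continuous f.
  move=> x; apply/differentiable_continuous/derivable1_diffP.
  by have [] := df x.
have mvt a b : a <= b ->
    exists2 c, a <= c <= b & f b - f a = f' c * (b - a).
  move=> ab; have [|c] := @MVT_segment R f f' a b ab (fun x _ => df x).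
    exact: continuous_subspaceT.
  by rewrite in_itv /=; exists c.
move=> x y; have [xy|/ltW yx] := leP x y.
  have [z /andP[xz zy] e] := mvt _ _ xy; exists z; first by lra.
  by rewrite [leRHS]distrC !ger0_norm; lra.
have [z /andP[yz zx] e] := mvt _ _ yx; exists z; first by lra.
by rewrite [leLHS]distrC !ger0_norm; lra.
Qed.

(** Compactness gives a uniform [d] for points close to each other; at distance at least [d] the
    trivial bound [2 * B] is absorbed by the quadratic term. The point [y] is unrestricted, and a
    quadratic error leads only to fourth moments of the gradients later. *)
Lemma local_unif_modulus (g : R -> R) (B : R) : continuous g ->
  (forall x, `|g x| <= B) -> forall e N, 0 < e -> exists2 K, 0 <= K &
  forall x y, `|x| <= N -> `|g x - g y| <= e + K * (x - y) ^+ 2.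
Proof.
move=> cg gB e N e0.
have /compact_near_coveringP cov := @segment_compact R (- N) N.
have : \forall d \near 0^'+, `[- N, N]%classic `<=`
    (fun x => forall y, `|x - y| < d -> `|g x - g y| <= e).
  apply: (cov _ (0^'+) (fun d x => forall y, `|x - y| < d -> `|g x - g y| <= e)).
  move=> x _; have e20 : 0 < e / 2 by rewrite divr_gt0.
  have /cvgrPdist_le /(_ _ e20) [r /= r0 rg] := cg x.
  near=> z d => y zy.
  have xz : `|x - z| < r / 2.
    near: z; apply: nbhsx_ballx; rewrite divr_gt0//.
  have dr : d < r / 2.
    near: d; apply: nbhs_right_lt; rewrite divr_gt0//.
  have h1 : `|g x - g z| <= e / 2 by apply: rg => /=; lra.
  have h2 : `|g x - g y| <= e / 2.
    apply: rg => /=; have hxy : `|x - y| <= `|x - z| + `|z - y| := ler_distD z x y.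
    by have : `|z - y| < d := zy; lra.
  by have := ler_distD (g x) (g z) (g y); rewrite [`|g z - g x|]distrC; lra.
move=> cov'; have [d [d0 dP]] : exists d, 0 < d /\ `[- N, N]%classic `<=`
    (fun x => forall y, `|x - y| < d -> `|g x - g y| <= e).
  near (0 : R)^'+ => d; exists d; split; first by [].
  by near: d.
(* With this constant the quadratic term is at least [2 * B] as soon as the distance is at least
   [d]. *)
exists (2 * B / d ^+ 2).
  by rewrite divr_ge0 ?sqr_ge0// mulr_ge0// (le_trans _ (gB 0)).
move=> x y xN; have [xy|dxy] := ltP `|x - y| d.
  apply: (le_trans (dP x _ _ xy)); first by rewrite /= in_itv /= -ler_norml.
  rewrite lerDl mulr_ge0 ?sqr_ge0// divr_ge0 ?sqr_ge0// mulr_ge0//.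
  exact: le_trans (gB 0).
apply: (@le_trans _ _ (2 * B)).
  by have := ler_normB (g x) (g y); have := gB x; have := gB y; lra.
apply: (@le_trans _ _ (2 * B / d ^+ 2 * (x - y) ^+ 2)); last by rewrite lerDr ltW.
rewrite [leRHS]mulrAC ler_pdivlMr ?exprn_gt0//.
rewrite ler_wpM2l ?mulr_ge0 ?(le_trans _ (gB 0))//.
by rewrite -[leRHS]real_normK ?num_real// lerXn2r ?nnegrE// ltW.
Unshelve. all: by end_near. Qed.

End SteinOperator.

(** * Stein's method for a quadratic form of variance 1 in Rademacher signs *)

Section SteinQuadraticForm.
Variables (R : realType) (n : nat) (a : 'I_n -> 'I_n -> R) (delta : R).
Hypothesis a_sym : forall i j, a i j = a j i.
Hypothesis a_diag : forall i, a i i = 0.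
Hypothesis a_norm : \sum_i \sum_j a i j ^+ 2 = 1 / 2.
Hypothesis a_row : forall i, \sum_j a i j ^+ 2 <= delta.
Hypothesis a_contr :
  \sum_j \sum_(l | l != j) (\sum_i a i j * a i l) ^+ 2 <= delta / 2.

Local Notation signs := {ffun 'I_n -> bool}.
Local Notation F := (qform a).

(* Half the discrete gradient: [F s - F (flip i s) = 4 * sgn (s i) * grad i s]. *)
Let grad (i : 'I_n) (s : signs) := \sum_j a i j * sgn R (s j).
Let S (s : signs) := \sum_i grad i s ^+ 2.

Let qform_grad s : F s = \sum_i sgn R (s i) * grad i s.
Proof.
apply: eq_bigr => i _; rewrite /grad mulr_sumr; apply: eq_bigr => j _.
by rewrite mulrCA.
Qed.

Let grad_flip i s : grad i (flip i s) = grad i s.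
Proof.
apply: eq_bigr => j _; rewrite sgn_flip; case: eqP => [->|//].
by rewrite a_diag !mul0r.
Qed.

(** The change is counted twice, which explains the 4: once in the [i]-th summand, whose gradient
    does not see the flip, and once through the effect of the flip on all other gradients. *)
Let qform_flip i s : F (flip i s) = F s - 4 * (sgn R (s i) * grad i s).
Proof.
have gj j : j != i -> grad j (flip i s) = grad j s - 2 * a j i * sgn R (s i).
  move=> ji; rewrite /grad (bigD1 i)//= [in RHS](bigD1 i)//= sgn_flip eqxx.
  rewrite (eq_bigr (fun l => a j l * sgn R (s l))); first by ring.
  by move=> l li; rewrite sgn_flip (negbTE li).
rewrite !qform_grad (bigD1 i)//= [in RHS](bigD1 i)//= sgn_flip eqxx grad_flip.
rewrite (eq_bigr (fun j => sgn R (s j) * grad j s -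
    2 * sgn R (s i) * (a i j * sgn R (s j)))); last first.
  by move=> j ji; rewrite sgn_flip (negbTE ji) gj// a_sym; ring.
rewrite sumrB -mulr_sumr.
have -> : \sum_(j < n | j != i) a i j * sgn R (s j) = grad i s.
  by rewrite /grad [RHS](bigD1 i)//= a_diag mul0r add0r.
ring.
Qed.

Let rmean_F2 : rmean (fun s => F s ^+ 2) = 1.
Proof. by rewrite rmean_qform_sq// a_norm; lra. Qed.

(** The diagonal part of the squared gradients adds up to [1 / 2] by [a_norm]; what remains is a
    quadratic form in the off-diagonal entries of the square of [a], so its second moment is
    known. *)
Let S_offdiag s : S s - 1 / 2 =
  qform (fun j l => if l == j then 0 else \sum_i a i j * a i l) s.
Proof.
have gE i : grad i s ^+ 2 = \sum_j a i j ^+ 2 + \sum_j \sum_(l | l != j)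
    a i j * a i l * (sgn R (s j) * sgn R (s l)).
  rewrite expr2 mulr_suml -big_split; apply: eq_bigr => j _ /=.
  rewrite mulr_sumr (bigD1 j)//= mulrACA sgn_sq mulr1 -expr2; congr (_ + _).
  by apply: eq_bigr => l _; rewrite mulrACA.
rewrite /S (eq_bigr _ (fun i _ => gE i)) big_split /= a_norm addrAC subrr add0r.
rewrite exchange_big /=; apply: eq_bigr => j _; rewrite exchange_big /=.
rewrite big_mkcond; apply: eq_bigr => l _; case: eqP => /= _; last first.
  by rewrite mulr_suml.
by rewrite mul0r.
Qed.

Let rmean_S : rmean S = 1 / 2.
Proof.
rewrite (eq_rmean (Y := fun s => 1 / 2 +
  qform (fun j l => if l == j then 0 else \sum_i a i j * a i l) s)).
  rewrite rmeanD rmean_cst /qform rmean_sum big1 ?addr0// => j _.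
  rewrite rmean_sum big1// => l _; rewrite rmeanZ.
  by case: eqP => [|/eqP lj]; rewrite ?mul0r// rmean_sgn2 ?mulr0// eq_sym.
by move=> s; rewrite -S_offdiag; lra.
Qed.

(** The second moment formula doubles the sum of squared off-diagonal entries, which [a_contr]
    bounds by [delta / 2]. *)
Let rmean_Svar : rmean (fun s => (S s - 1 / 2) ^+ 2) <= delta.
Proof.
rewrite (eq_rmean (Y := fun s =>
  qform (fun j l => if l == j then 0 else \sum_i a i j * a i l) s ^+ 2)); last first.
  by move=> s; rewrite S_offdiag.
rewrite rmean_qform_sq; first last.
- by move=> i; rewrite eqxx.
- move=> j l; rewrite eq_sym; case: eqP => // _; apply: eq_bigr => i _.
  exact: mulrC.
rewrite mulrC -ler_pdivlMr//; apply: le_trans a_contr.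
apply: ler_sum => j _; rewrite [leRHS]big_mkcond; apply: ler_sum => l _ /=.
by case: eqP => //=; rewrite expr0n.
Qed.

(** In the Khintchine bound one squared row norm is at most [delta] by [a_row], while the other sums
    to [1 / 2]. *)
Let rmean_grad4 : rmean (fun s => \sum_i grad i s ^+ 4) <= 3 / 2 * delta.
Proof.
rewrite rmean_sum; apply: (@le_trans _ _ (\sum_i 3 * delta * \sum_j a i j ^+ 2)).
  apply: ler_sum => i _; apply: le_trans (rmean_linear_pow4 _) _.
  rewrite expr2 mulrA; apply: ler_wpM2r; last by rewrite ler_wpM2l.
  by apply: sumr_ge0 => j _; exact: sqr_ge0.
by rewrite -mulr_sumr a_norm; lra.
Qed.

Variables (f f' : R -> R) (B e K N eta : R).
Hypothesis df : forall x : R, is_derive x 1 f (f' x).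
Hypothesis f'B : forall x, `|f' x| <= B.
Hypothesis K0 : 0 <= K.
Hypothesis N0 : 0 < N.
Hypothesis eta0 : 0 < eta.
Hypothesis f'_modulus : forall x y, `|x| <= N ->
  `|f' x - f' y| <= e + K * (x - y) ^+ 2.

(** The four errors come from the modulus of [f'], the fourth moments of the gradients, the
    fluctuation of [S] around [1 / 2], and the event that [F] exceeds [N] in absolute value. *)
Lemma stein_qform_bound :
  `|rmean (fun s => F s * f (F s)) - rmean (fun s => f' (F s))| <=
  e + 48 * K * delta + 3 * B * (eta + delta / eta) + 2 * B / N ^+ 2.
Proof.
have B0 : 0 <= B by apply: le_trans (f'B 0).
pose tau i (s : signs) := sgn R (s i) * grad i s.
have tau2 i s : tau i s ^+ 2 = grad i s ^+ 2.
  by rewrite exprMn expr2 sgn_sq mul1r.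
pose u (s : signs) := if N < `|F s| then 2 * B else 0.
have u0 s : 0 <= u s by rewrite /u; case: ifP => // _; rewrite mulr_ge0.
have uB s : u s <= 2 * B by rewrite /u; case: ifP => // _; rewrite mulr_ge0.
have uF s : u s <= 2 * B / N ^+ 2 * F s ^+ 2.
  rewrite /u; case: ifPn => [NF|_]; last first.
    by rewrite mulr_ge0 ?sqr_ge0// divr_ge0 ?sqr_ge0// mulr_ge0.
  rewrite mulrAC ler_pdivlMr ?exprn_gt0// ler_wpM2l ?mulr_ge0//.
  by rewrite -[leRHS]real_normK ?num_real// lerXn2r ?nnegrE ?(ltW N0) ?(ltW NF).
have f'_mod s y : `|f' (F s) - f' y| <= e + K * (F s - y) ^+ 2 + u s.
  rewrite /u; case: ifPn => [_|]; last by rewrite -leNgt addr0; apply: f'_modulus.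
  have e0 : 0 <= e.
    have := @f'_modulus 0 0; rewrite normr0 !subrr normr0 expr0n /= mulr0 addr0.
    by apply; exact: ltW.
  have := ler_normB (f' (F s)) (f' y); have := f'B (F s); have := f'B y.
  have : 0 <= K * (F s - y) ^+ 2 by rewrite mulr_ge0 ?sqr_ge0.
  lra.
(* Symmetrisation: [tau i] changes sign under [flip i] and the law does not, so [tau i s * f (F s)]
   and [D i s] have the same mean. *)
pose D i (s : signs) := tau i s * (f (F s) - f (F (flip i s))) / 2.
have rD : rmean (fun s => F s * f (F s)) = rmean (fun s => \sum_i D i s).
  rewrite (eq_rmean (Y := fun s => \sum_i tau i s * f (F s))); last first.
    by move=> s; rewrite {1}qform_grad mulr_suml.
  rewrite !rmean_sum; apply: eq_bigr => i _.
  rewrite [RHS](eq_rmean (Y := fun s => 2^-1 * (tau i s * f (F s)) +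
      2^-1 * (- tau i s * f (F (flip i s))))); last by move=> s; rewrite /D; field.
  rewrite rmeanD !rmeanZ; set x := rmean _; set y := rmean (fun s => - _ * _).
  suff -> : y = x by lra.
  rewrite /x -(rmean_flip i); apply: eq_rmean => s /=.
  by rewrite /tau grad_flip sgn_flip eqxx !mulNr.
(* The increment of [F] is [4 * tau i s], so [D i s] equals [2 * grad i s ^+ 2] times [f'] at an
   intermediate point, whose squared distance to [F s] is at most [16 * grad i s ^+ 2]. *)
have D_approx i s : `|D i s - 2 * grad i s ^+ 2 * f' (F s)| <=
    2 * e * grad i s ^+ 2 + 32 * K * grad i s ^+ 4 + 2 * grad i s ^+ 2 * u s.
  have [z fz zF] := mvt_between df (F s) (F (flip i s)).
  have FF : F s - F (flip i s) = 4 * tau i s by rewrite qform_flip /tau; ring.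
  have -> : D i s - 2 * grad i s ^+ 2 * f' (F s) =
      2 * grad i s ^+ 2 * (f' z - f' (F s)).
    by rewrite /D fz FF -tau2; field.
  have g2 : 0 <= 2 * grad i s ^+ 2 := mulr_ge0 (ler0n _ 2) (sqr_ge0 _).
  rewrite normrM (ger0_norm g2).
  have zF2 : (F s - z) ^+ 2 <= 16 * grad i s ^+ 2.
    rewrite -[leLHS]real_normK ?num_real// distrC -tau2.
    have -> : 16 * tau i s ^+ 2 = `|F s - F (flip i s)| ^+ 2.
      by rewrite real_normK ?num_real// FF; ring.
    by rewrite lerXn2r ?nnegrE.
  have := f'_mod s z; rewrite distrC => h.
  have {}h : `|f' z - f' (F s)| <= e + K * (16 * grad i s ^+ 2) + u s.
    by apply: le_trans h _; rewrite lerD2r lerD2l ler_wpM2l.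
  apply: le_trans (ler_wpM2l g2 h) _.
  by rewrite le_eqVlt; apply/orP; left; apply/eqP; ring.
have S0 s : 0 <= S s by apply: sumr_ge0 => i _; exact: sqr_ge0.
(* Weighted arithmetic-geometric mean inequality, replacing a first absolute moment by the variance
   of [S]. *)
have amgm s : `|2 * S s - 1| <= eta + (S s - 1 / 2) ^+ 2 / eta.
  have -> : 2 * S s - 1 = 2 * (S s - 1 / 2) by lra.
  rewrite normrM ger0_norm// -[(S s - _) ^+ 2]real_normK ?num_real//.
  set t := `|S s - _|; rewrite -subr_ge0.
  have -> : eta + t ^+ 2 / eta - 2 * t = (eta - t) ^+ 2 / eta.
    by field; rewrite gt_eqF.
  by rewrite divr_ge0 ?sqr_ge0// ltW.
pose bnd (s : signs) := 2 * e * S s + 32 * K * (\sum_i grad i s ^+ 4) +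
  2 * B / N ^+ 2 * F s ^+ 2 + 3 * B * (eta + (S s - 1 / 2) ^+ 2 / eta).
have pointwise s : `|(\sum_i D i s) - f' (F s)| <= bnd s.
  have -> : (\sum_i D i s) - f' (F s) =
      \sum_i (D i s - 2 * grad i s ^+ 2 * f' (F s)) + (2 * S s - 1) * f' (F s).
    have gradS : \sum_i 2 * grad i s ^+ 2 * f' (F s) = 2 * S s * f' (F s).
      by rewrite -mulr_suml -mulr_sumr.
    by rewrite sumrB gradS; ring.
  apply: le_trans (ler_normD _ _) _.
  have h1 : `|\sum_i (D i s - 2 * grad i s ^+ 2 * f' (F s))| <=
      2 * e * S s + 32 * K * (\sum_i grad i s ^+ 4) + 2 * S s * u s.
    apply: le_trans (ler_norm_sum _ _ _) _.
    apply: le_trans (ler_sum _ (fun i _ => D_approx i s)) _.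
    by rewrite !big_split /= -mulr_suml -!mulr_sumr.
  have h2 : `|(2 * S s - 1) * f' (F s)| <= `|2 * S s - 1| * B.
    by rewrite normrM ler_wpM2l.
  (* Splitting [2 * S s] as [(2 * S s - 1) + 1] avoids the joint moment of [S] and [u]; together
     with [h2] the fluctuation gets the factor [3 * B]. *)
  have h3 : 2 * S s * u s <= `|2 * S s - 1| * (2 * B) + u s.
    have : (2 * S s - 1) * u s <= `|2 * S s - 1| * u s.
      by rewrite ler_wpM2r// ler_norm.
    have : `|2 * S s - 1| * u s <= `|2 * S s - 1| * (2 * B) by rewrite ler_wpM2l.
    lra.
  have h4 : 3 * B * `|2 * S s - 1| <= 3 * B * (eta + (S s - 1 / 2) ^+ 2 / eta).
    by rewrite ler_wpM2l// mulr_ge0.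
  have := uF s; rewrite /bnd; lra.
rewrite rD -rmeanB; apply: (@le_trans _ _ (rmean bnd)).
  rewrite ler_norml; apply/andP; split.
    rewrite -subr_ge0 opprK -rmeanD; apply: rmean_ge0 => s.
    by have := pointwise s; rewrite ler_norml; lra.
  by apply: ler_rmean => s; have := pointwise s; rewrite ler_norml => /andP[].
rewrite /bnd !rmeanD !rmeanZ rmeanD rmean_cst rmean_S rmean_F2.
rewrite (eq_rmean (X := fun s => (S s - 1 / 2) ^+ 2 / eta)
  (Y := fun s => eta^-1 * (S s - 1 / 2) ^+ 2)); last first.
  by move=> s; rewrite mulrC.
rewrite rmeanZ.
have h5 : 32 * K * rmean (fun s => \sum_i grad i s ^+ 4) <= 32 * K * (3 / 2 * delta).
  by rewrite ler_wpM2l// mulr_ge0.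
have h6 : 3 * B * (eta^-1 * rmean (fun s => (S s - 1 / 2) ^+ 2)) <=
    3 * B * (delta / eta).
  rewrite ler_wpM2l ?mulr_ge0// [leRHS]mulrC ler_wpM2l// invr_ge0 ltW//.
lra.
Qed.

End SteinQuadraticForm.

(** * The projection matrix and the kernel of the standardised statistic *)

Section Projection.
Variables (R : realType) (n k : nat) (G : 'M[R]_(n, k)).
Hypothesis rankP : \rank (projP G) = k.
Local Notation p := (projP G).

(** The rank of the product [projP G] bounds that of [invmx (G^T *m G)] from below, so the latter
    has full rank; as [invmx] fixes singular matrices, its invertibility is that of the Gram
    matrix. *)
Let gram_unit : G^T *m G \in unitmx.
Proof.
rewrite -unitmx_inv -row_full_unit -col_leq_rank -[X in (X <= _)%N]rankP.
rewrite /projP -mulmxA; apply: leq_trans (mxrankM_maxr _ _) _.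
exact: mxrankM_maxl.
Qed.

Lemma projP_sym i j : p i j = p j i.
Proof.
suff pT : p^T = p by rewrite -[in LHS]pT mxE.
by rewrite /projP !trmx_mul trmxK trmx_inv trmx_mul trmxK mulmxA.
Qed.

Lemma projP_idem : p *m p = p.
Proof.
by rewrite /projP !mulmxA -(mulmxA _ G^T G) mulmxKV.
Qed.

Lemma projP_tr : \sum_i p i i = k%:R.
Proof.
rewrite -[LHS]/(\tr p) /projP -mulmxA mxtrace_mulC -mulmxA mulVmx//.
exact: mxtrace1.
Qed.

Lemma projP_row i j : \sum_l p i l * p l j = p i j.
Proof. by rewrite -[in RHS]projP_idem mxE. Qed.

Lemma projP_row_sq i : \sum_j p i j ^+ 2 = p i i.
Proof.
rewrite -[RHS]projP_row; apply: eq_bigr => j _.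
by rewrite expr2 [p j i]projP_sym.
Qed.

(** The diagonal entry is the squared norm of its row, hence dominates its own square. *)
Lemma projP_diag i : 0 <= p i i <= 1.
Proof.
have p0 : 0 <= p i i.
  by rewrite -projP_row_sq sumr_ge0// => j _; exact: sqr_ge0.
have : p i i ^+ 2 <= p i i.
  rewrite -[leRHS]projP_row_sq (bigD1 i)//= lerDl sumr_ge0// => j _.
  exact: sqr_ge0.
rewrite p0 /= => pp; have [//|p1] := leP.
have : p i i * 1 < p i i * p i i by rewrite ltr_pM2l// (lt_trans _ p1).
by rewrite mulr1 -expr2 ltNge pp.
Qed.

Let v := k%:R * sigma2 G.
Hypothesis v0 : 0 < v.

Let vE : v = 2 * \sum_i \sum_(j | i != j) p i j ^+ 2.
Proof.
rewrite /v /sigma2 mulrA [k%:R * _]mulrC divfK//.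
(* The division by [k] is legitimate because [k = 0] would force [v = 0]. *)
by apply: contraTneq v0; rewrite /v => ->; rewrite mul0r ltxx.
Qed.

Let a i j := if i == j then 0 else p i j / Num.sqrt v.

(** Since signs square to 1, the diagonal terms add up to the trace [k] and cancel the centring
    exactly. *)
Lemma normalize_ARr s : normalize G (ARr G s) = qform a s.
Proof.
rewrite /normalize -/v.
have -> : ARr G s - k%:R =
    \sum_i \sum_(j | j != i) p i j * (sgn R (s i) * sgn R (s j)).
  rewrite /ARr /quadP -projP_tr -sumrB; apply: eq_bigr => i _.
  rewrite (bigD1 i)//= mulrAC sgn_sq mul1r addrAC subrr add0r.
  by apply: eq_bigr => j _; rewrite mulrAC mulrC.
rewrite mulr_sumr; apply: eq_bigr => i _; rewrite mulr_sumr.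
rewrite big_mkcond; apply: eq_bigr => j _.
rewrite /a [j == i]eq_sym; case: eqP => /= _; first by rewrite mul0r.
by ring.
Qed.

Let a_sym i j : a i j = a j i.
Proof. by rewrite /a eq_sym projP_sym. Qed.

Let a_diag i : a i i = 0.
Proof. by rewrite /a eqxx. Qed.

Let a_sq i j : a i j ^+ 2 = (if i == j then 0 else p i j ^+ 2) / v.
Proof.
rewrite /a; case: eqP => _; first by rewrite expr0n mul0r.
by rewrite exprMn exprVn sqr_sqrtr// ltW.
Qed.

Let a_norm : \sum_i \sum_j a i j ^+ 2 = 1 / 2.
Proof.
have -> : \sum_i \sum_j a i j ^+ 2 = (\sum_i \sum_(j | i != j) p i j ^+ 2) / v.
  rewrite mulr_suml; apply: eq_bigr => i _; rewrite mulr_suml [RHS]big_mkcond.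
  by apply: eq_bigr => j _; rewrite a_sq; case: eqP => //= _; rewrite mul0r.
move: v0; rewrite vE; set t := \sum_i _ => t0.
by field; apply: contraTneq t0 => ->; rewrite mulr0 ltxx.
Qed.

Let a_row i : \sum_j a i j ^+ 2 <= v^-1.
Proof.
apply: (@le_trans _ _ ((\sum_j p i j ^+ 2) / v)).
  rewrite mulr_suml; apply: ler_sum => j _; rewrite a_sq ler_wpM2r ?invr_ge0 ?(ltW v0)//.
  by case: eqP => // _; exact: sqr_ge0.
rewrite projP_row_sq ler_piMl ?invr_ge0 ?(ltW v0)//.
by have /andP[] := projP_diag i.
Qed.

(** Idempotence gives the full sum of [p j i * p i l]; the zero diagonal of [a] removes the terms
    [i = j] and [i = l]. *)
Let a_mul j l : l != j -> \sum_i a i j * a i l = p j l * (1 - p j j - p l l) / v.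
Proof.
move=> lj; have vv : v = Num.sqrt v * Num.sqrt v by rewrite -expr2 sqr_sqrtr// ltW.
have -> : p j l * (1 - p j j - p l l) = \sum_(i | (i != j) && (i != l)) p j i * p i l.
  rewrite -[p j l in LHS]mulr1 -mulrA; have := projP_row j l.
  rewrite (bigD1 j)//= (bigD1 l)//=; set t := \sum_(i | _) _.
  by lra.
rewrite mulr_suml [RHS]big_mkcond; apply: eq_bigr => i _.
rewrite /a; case: eqP => /= [_|_]; first by rewrite mul0r.
case: eqP => /= _; first by rewrite mulr0.
by rewrite [p i j]projP_sym {3}vv invfM; ring.
Qed.

(** The factor [1 - p j j - p l l] lies in [[-1, 1]], and the squared off-diagonal entries of [p]
    sum to [v / 2]. *)
Let a_contr :
  \sum_j \sum_(l | l != j) (\sum_i a i j * a i l) ^+ 2 <= v^-1 / 2.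
Proof.
have -> : v^-1 / 2 = (\sum_j \sum_(l | l != j) p j l ^+ 2) / v ^+ 2.
  have -> : \sum_j \sum_(l | l != j) p j l ^+ 2 = v / 2.
    rewrite vE mulrAC divff ?mul1r ?pnatr_eq0//; apply: eq_bigr => i _.
    by apply: eq_bigl => j; rewrite eq_sym.
  by field; rewrite gt_eqF.
rewrite mulr_suml; apply: ler_sum => j _; rewrite mulr_suml; apply: ler_sum => l lj.
rewrite a_mul// exprMn exprVn ler_wpM2r ?invr_ge0 ?sqr_ge0//.
rewrite exprMn ler_piMr ?sqr_ge0//.
have /andP[? ?] := projP_diag j; have /andP[? ?] := projP_diag l.
by rewrite -[_ ^+ 2]real_normK ?num_real// exprn_ile1// ler_norml; lra.
Qed.

Lemma stein_AR_bound (f f' : R -> R) (B e K N eta : R) :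
  (forall x : R, is_derive x 1 f (f' x)) -> (forall x, `|f' x| <= B) ->
  0 <= K -> 0 < N -> 0 < eta ->
  (forall x y, `|x| <= N -> `|f' x - f' y| <= e + K * (x - y) ^+ 2) ->
  `|rmean (fun s => normalize G (ARr G s) * f (normalize G (ARr G s))) -
    rmean (fun s => f' (normalize G (ARr G s)))| <=
  e + 48 * K * v^-1 + 3 * B * (eta + v^-1 / eta) + 2 * B / N ^+ 2.
Proof.
move=> df f'B K0 N0 eta0 f'mod.
rewrite (eq_rmean (Y := fun s => qform a s * f (qform a s))); last first.
  by move=> s; rewrite normalize_ARr.
rewrite (eq_rmean (X := fun s => f' _) (Y := fun s => f' (qform a s))); last first.
  by move=> s; rewrite normalize_ARr.
exact: (stein_qform_bound a_sym a_diag a_norm a_row a_contr df f'B).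
Qed.

End Projection.

(** The threshold [V] depends only on [f], [f'], [B] and [e]: first [N] is fixed, then [K] and
    [eta], and finally [v] is taken large. *)
Lemma stein_AR (R : realType) (f f' : R -> R) (B : R) :
  (forall x : R, is_derive x 1 f (f' x)) -> continuous f' ->
  (forall x, `|f' x| <= B) -> forall e, 0 < e -> exists V : R,
  forall n k (G : 'M[R]_(n, k)), \rank (projP G) = k -> V < k%:R * sigma2 G ->
  `|rmean (fun s => normalize G (ARr G s) * f (normalize G (ARr G s))) -
    rmean (fun s => f' (normalize G (ARr G s)))| <= e.
Proof.
move=> df cf' f'B e e0; have B0 : 0 <= B by apply: le_trans (f'B 0).
pose N := 1 + 8 * B / e.
have N1 : 1 <= N by rewrite /N lerDl divr_ge0 ?mulr_ge0 ?(ltW e0).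
have e40 : 0 < e / 4 by rewrite divr_gt0.
have [K K0 Kmod] := local_unif_modulus cf' f'B N e40.
(* Makes [3 * B * eta] at most [e / 8]; [B + 1] keeps the denominator positive when [B = 0]. *)
pose eta := e / (24 * (B + 1)).
have B10 : 0 < 24 * (B + 1) by lra.
have eta0 : 0 < eta by rewrite divr_gt0.
(* The total coefficient of [v^-1] in the bound. *)
pose M := 48 * K + 3 * B / eta.
have M0 : 0 <= M.
  by apply: addr_ge0; rewrite ?mulr_ge0 ?invr_ge0 ?(ltW eta0).
exists (4 * M / e) => n k G rk; set v := k%:R * _ => Vv.
have v0 : 0 < v by apply: le_lt_trans Vv; rewrite divr_ge0 ?mulr_ge0 ?(ltW e0).
apply: le_trans (stein_AR_bound rk v0 df f'B K0 _ eta0 Kmod) _.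
  by apply: lt_le_trans N1.
rewrite -/v.
have h1 : 2 * B / N ^+ 2 <= e / 4.
  rewrite ler_pdivrMr ?exprn_gt0 ?(lt_le_trans _ N1)//.
  have : 8 * B / e <= N ^+ 2.
    apply: (@le_trans _ _ N); first by rewrite /N lerDr.
    by rewrite expr2 ler_peMr// (le_trans _ N1).
  by rewrite ler_pdivrMr//; lra.
have h2 : 3 * B * eta <= e / 8.
  by rewrite /eta mulrA ler_pdivrMr//; nra.
have h3 : M * v^-1 <= e / 4.
  rewrite ler_pdivrMr//; move: Vv; rewrite ltr_pdivrMr//; lra.
have : 48 * K * v^-1 + 3 * B * (v^-1 / eta) = M * v^-1 by rewrite /M; ring.
lra.
Qed.

(** * Gaussian tails and the solution of Stein's equation *)

Section SteinEquation.
Variable R : realType.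
Local Notation mu := (@lebesgue_measure R).
Local Notation phi := (@normal_pdf R 0 1).

Lemma normal_pdf01E x : phi x = normal_peak 1 * expR (- x ^+ 2 / 2).
Proof.
by rewrite normal_pdfE ?oner_eq0// /normal_fun subr0 expr1n.
Qed.

Lemma normal_pdf01_gt0 x : 0 < phi x.
Proof. by rewrite normal_pdf01E mulr_gt0 ?expR_gt0 ?normal_peak_gt0. Qed.

Lemma normal_pdf01N x : phi (- x) = phi x.
Proof. by rewrite !normal_pdf01E sqrrN. Qed.

Lemma is_derive_normal_pdf01 (x : R) : is_derive x 1 phi (- (x * phi x)).
Proof.
have -> : phi = (fun x => normal_peak 1 * expR (- x ^+ 2 / 2)).
  by apply/funext => y; exact: normal_pdf01E.
have d2 : is_derive x 1 (fun y : R => - y ^+ 2 / 2) (- x).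
  have -> : (fun y : R => - y ^+ 2 / 2) = (- 2^-1) *: ((@id R) * (@id R)).
    by apply/funext => y; rewrite /= mulNr mulrC -mulNr.
  apply: (is_derive_eq (is_deriveZ (- 2^-1)
    (is_deriveM (is_derive_id x (1 : R)) (is_derive_id x (1 : R))))).
  by rewrite /GRing.scale /=; field.
have de := is_derive1_comp (is_derive_expR _) d2.
have -> : - (x * (normal_peak 1 * expR (- x ^+ 2 / 2))) =
    normal_peak 1 *: (expR (- x ^+ 2 / 2) * - x).
  by rewrite /GRing.scale /=; ring.
by apply: is_deriveZ.
Qed.

Lemma normal_pdf01_cvgy : phi x @[x --> +oo] --> (0 : R).
Proof.
apply: (@squeeze_cvgr _ _ _ _ (fun=> 0) (fun x => normal_peak 1 * expR (- x))).
- near=> x; rewrite ltW ?normal_pdf01_gt0//= normal_pdf01E.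
  rewrite ler_wpM2l ?normal_peak_ge0// ler_expR mulNr lerN2 ler_pdivlMr//.
  by rewrite expr2 ler_wpM2l//; near: x; apply: nbhs_pinfty_ge; rewrite num_real.
- exact: cvg_cst.
- rewrite -[X in _ --> X](mulr0 (normal_peak 1)); apply: cvgM.
    exact: cvg_cst.
  exact: cvgr_expR.
Unshelve. all: by end_near. Qed.

(** Mills' inequality: [phi x] is the integral of [y * phi y] over the tail, where [y] is at least
    [x]. *)
Lemma normal_tail_bound x : 0 <= x ->
  ((x%:E * \int[mu]_(y in `[x, +oo[) (phi y)%:E) <= (phi x)%:E)%E.
Proof.
move=> x0.
have mphi : measurable_fun setT phi := @measurable_normal_pdf R 0 1.
have -> : ((phi x)%:E = \int[mu]_(y in `[x, +oo[) (y * phi y)%:E)%E.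
  rewrite (@ge0_continuous_FTC2y _ _ (fun y => - phi y) _ 0).
  - by rewrite EFinN oppeK add0e.
  - by move=> y xy; rewrite mulr_ge0 ?normal_pdf_ge0// (le_trans x0).
  - apply: continuous_subspaceT => y; apply: cvgM => //.
    exact: continuous_normal_pdf.
  - by rewrite -[X in _ --> X]oppr0; apply: cvgN; exact: normal_pdf01_cvgy.
  - by move=> y _; have [] := is_deriveN (is_derive_normal_pdf01 y).
  - apply: cvg_at_right_filter; apply: cvgN; exact: continuous_normal_pdf.
  - move=> y _; rewrite derive1E; have d := is_deriveN (is_derive_normal_pdf01 y).
    by rewrite (@derive_val _ _ _ _ _ _ _ d) opprK.
rewrite -ge0_integralZl//; last 2 first.
- by apply/measurable_EFinP; exact: measurable_funS mphi.
- by move=> y _; rewrite lee_fin normal_pdf_ge0.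
apply: ge0_le_integral => //.
- by move=> y _; rewrite mule_ge0// lee_fin ?normal_pdf_ge0.
- apply: measurable_funeM; apply/measurable_EFinP; exact: measurable_funS mphi.
- apply/measurable_EFinP; apply: measurable_funM => //.
  exact: measurable_funS mphi.
- move=> y /=; rewrite in_itv /= andbT => xy.
  by rewrite -EFinM lee_fin ler_wpM2r ?normal_pdf_ge0.
Qed.

Lemma normal_left_tail x :
  (\int[mu]_(y in `]-oo, (- x)%R]) (phi y)%:E =
   \int[mu]_(y in `[x, +oo[) (phi y)%:E)%E.
Proof.
rewrite ge0_integration_by_substitutionNy.
- by apply: eq_integral => y _; rewrite /= normal_pdf01N.
- by apply: continuous_subspaceT; exact: continuous_normal_pdf.
- by move=> y _; exact: normal_pdf_ge0.
Qed.

Lemma dominated_normal_integrable (q : R -> R) : continuous q ->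
  (forall x, `|q x| <= phi x) -> mu.-integrable setT (EFin \o q).
Proof.
move=> cq qphi; apply: le_integrable (integrable_normal_pdf 0 1) => //.
  by apply/measurable_EFinP; exact: continuous_measurable_fun.
by move=> x _ /=; rewrite lee_fin (le_trans (qphi x)) ?ler_norm.
Qed.

Lemma dominated_Rintegral_bound (q : R -> R) (D : set R) : continuous q ->
  (forall x, `|q x| <= phi x) -> measurable D ->
  (`|\int[mu]_(x in D) q x|%:E <= \int[mu]_(x in D) (phi x)%:E)%E.
Proof.
move=> cq qphi mD.
have qint : mu.-integrable D (EFin \o q).
  by apply: integrableS (dominated_normal_integrable cq qphi).
rewrite EFin_normr_Rintegral//.
apply: le_trans (le_abse_integral _ _ _) _ => //.
  by case/integrableP : qint.
apply: ge0_le_integral => //.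
- apply: measurableT_comp => //.
  by case/integrableP : qint.
- apply/measurable_EFinP; apply: measurable_funS (@measurable_normal_pdf R 0 1) => //.
- by move=> x _; rewrite lee_fin.
Qed.

(** For nonnegative [x] the vanishing total integral trades the left integral for the right tail;
    for negative [x] the left tail is reflected. Mills' inequality applies in both cases. *)
Lemma primitive_tail_bound (q : R -> R) x : continuous q ->
  (forall x, `|q x| <= phi x) -> \int[mu]_y q y = 0 ->
  `|x * \int[mu]_(y in `]-oo, x]) q y| <= phi x.
Proof.
move=> cq qphi q0.
suff : ((`|x|%:E * `|\int[mu]_(y in `]-oo, x]) q y|%:E) <= (phi x)%:E)%E.
  by rewrite -EFinM lee_fin normrM.
have [x0|x0] := leP 0 x.
  have -> : \int[mu]_(y in `]-oo, x]) q y = - \int[mu]_(y in `]x, +oo[) q y.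
    apply/eqP; rewrite -addr_eq0 -Rintegral_setU//=.
    - by rewrite itv_setU_setT q0.
    - rewrite itv_setU_setT; exact: dominated_normal_integrable.
    - apply/disj_setPS => y [] /=; rewrite !in_itv /= andbT => yx.
      by rewrite ltNge yx.
  rewrite normrN (ger0_norm x0); apply: le_trans (normal_tail_bound x0).
  apply: lee_pmul => //; apply: le_trans (dominated_Rintegral_bound cq qphi _) _ => //.
  apply: ge0_subset_integral => //.
  - by apply/measurable_EFinP; apply: measurable_funS (@measurable_normal_pdf R 0 1).
  - by move=> y _; rewrite lee_fin normal_pdf_ge0.
  - by move=> y /=; rewrite !in_itv /= !andbT => /ltW.
rewrite (ltr0_norm x0) -[phi x]normal_pdf01N; have Nx0 : 0 <= - x by rewrite oppr_ge0 ltW.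
apply: le_trans (normal_tail_bound Nx0); rewrite -normal_left_tail opprK.
apply: lee_pmul => //; exact: dominated_Rintegral_bound.
Qed.

(** The solution is the primitive of [(h - c) * phi] divided by [phi]. Each of [x * f x] and
    [h x - c] is at most 1 in absolute value, hence the bound 2. *)
Lemma stein_equation (h : R -> R) : continuous h -> (forall x, 0 <= h x <= 1) ->
  let c := \int[mu]_x (h x * phi x) in
  exists f : R -> R, (forall x : R, is_derive x 1 f (x * f x + (h x - c))) /\
    (forall x, `|x * f x + (h x - c)| <= 2).
Proof.
move=> ch h01 c.
have cphi : continuous phi by exact: continuous_normal_pdf.
have hphi_int : mu.-integrable setT (EFin \o (fun x => h x * phi x)).
  apply: dominated_normal_integrable.
    by move=> x; apply: cvgM; [exact: ch|exact: cphi].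
  move=> x; have /andP[h0 h1] := h01 x.
  by rewrite ger0_norm ?mulr_ge0 ?normal_pdf_ge0// ler_piMl ?normal_pdf_ge0.
have phi1 : \int[mu]_x phi x = 1 by rewrite /Rintegral integral_normal_pdf.
have c01 : 0 <= c <= 1.
  apply/andP; split.
    apply: Rintegral_ge0 => x _; have /andP[h0 h1] := h01 x.
    by rewrite mulr_ge0 ?normal_pdf_ge0.
  rewrite -phi1; apply: le_Rintegral => //; first exact: integrable_normal_pdf.
  by move=> x _; have /andP[h0 h1] := h01 x; rewrite ler_piMl ?normal_pdf_ge0.
have hc1 x : `|h x - c| <= 1.
  by have := h01 x; rewrite ler_norml; lra.
pose q x := (h x - c) * phi x.
have cq : continuous q.
  move=> x; apply: cvgM; last exact: cphi.
  by apply: cvgB; [exact: ch|exact: cvg_cst].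
have qphi x : `|q x| <= phi x.
  by rewrite normrM [`|phi x|]ger0_norm ?normal_pdf_ge0// ler_piMl ?normal_pdf_ge0.
(* This is why [c] is the Gaussian mean of [h]. *)
have q0 : \int[mu]_x q x = 0.
  rewrite /q; under eq_Rintegral do rewrite mulrBl.
  rewrite RintegralB//; last first.
    have := integrableZl measurableT c (@integrable_normal_pdf R 0 1).
    by apply: eq_integrable.
  rewrite RintegralZl//; last exact: integrable_normal_pdf.
  by rewrite phi1 mulr1 subrr.
pose H x := \int[mu]_(y in `]-oo, x]) q y.
have dH (x : R) : is_derive x 1 H (q x).
  have [|||dx Hx] := @continuous_FTC1 R q -oo%O x (x + 1) _ _ _ (cq x).
  - by rewrite ltrDl.
  - by apply: integrableS (dominated_normal_integrable cq qphi).
  - exact: ltNyr.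
  by apply: (DeriveDef dx); rewrite -derive1E Hx.
have Hb x : `|x * H x| <= phi x by exact: primitive_tail_bound.
have phi0 x : phi x != 0 by rewrite gt_eqF ?normal_pdf01_gt0.
pose f x := H x * (phi x)^-1.
exists f; split => [x|x]; last first.
  rewrite (le_trans (ler_normD _ _))// -[leRHS]/(1 + 1) lerD//.
  rewrite /f mulrA normrM normfV [`|phi x|]ger0_norm ?normal_pdf_ge0//.
  by rewrite ler_pdivrMr ?normal_pdf01_gt0// mul1r.
have dV := is_deriveV (phi0 x) (is_derive_normal_pdf01 x).
apply: (is_derive_eq (is_deriveM (dH x) dV)).
rewrite /f /q /GRing.scale /= expr2; field.
exact: phi0.
Qed.

End SteinEquation.

(** * From test functions to distribution functions *)

Section NormalLimit.
Variable R : realType.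
Local Notation mu := (@lebesgue_measure R).
Local Notation phi := (@normal_pdf R 0 1).
Local Notation Phi := (Defs.cdf (@normal_prob R 0 1)).

Lemma AR_test_function (h : R -> R) : continuous h -> (forall x, 0 <= h x <= 1) ->
  forall e : R, 0 < e -> exists V : R, forall n k (G : 'M[R]_(n, k)),
  \rank (projP G) = k -> V < k%:R * sigma2 G ->
  `|rmean (fun s => h (normalize G (ARr G s))) - \int[mu]_x (h x * phi x)| <= e.
Proof.
move=> ch h01 e e0; have [f [df f'2]] := stein_equation ch h01.
set c := \int[mu]_x _ in df f'2 *.
have cf' : continuous (fun x : R => x * f x + (h x - c)).
  move=> x; apply: cvgD; last by apply: cvgB; [exact: ch|exact: cvg_cst].
  apply: cvgM; first exact: cvg_id.
  by apply/differentiable_continuous/derivable1_diffP; have [] := df x.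
have [V VP] := stein_AR df cf' f'2 e0.
exists V => n k G rk Vv; apply: le_trans (VP n k G rk Vv).
by rewrite rmeanD rmeanB rmean_cst opprD addNKr normrN.
Qed.

(** For [a < b], equal to 1 up to [a], 0 from [b] on, and affine between: a continuous function
    squeezed between two half-line indicators. *)
Definition ramp (a b x : R) : R := Num.min 1 (Num.max 0 ((b - x) / (b - a))).

Lemma continuous_ramp a b : continuous (ramp a b).
Proof.
move=> x.
have cq : {for x, continuous (fun y : R => (b - y) / (b - a))}.
  by apply: cvgM; [apply: cvgB; [exact: cvg_cst|exact: cvg_id]|exact: cvg_cst].
have ck (c : R) : {for x, continuous (fun=> c)} by exact: cvg_cst.
exact: continuous_min (ck 1) (continuous_max (ck 0) cq).
Qed.

Lemma ramp01 a b x : 0 <= ramp a b x <= 1.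
Proof. by rewrite /ramp le_min ge_min ler01 le_max !lexx. Qed.

Lemma ramp_le a b x : a < b -> ramp a b x <= (x <= b)%R%:R.
Proof.
move=> ab; have [xb|bx] := leP x b.
  by have /andP[] := ramp01 a b x.
rewrite /ramp ge_min ge_max lexx /= orbC; apply/orP; left.
by rewrite pmulr_lle0 ?invr_gt0 ?subr_gt0// subr_le0 ltW.
Qed.

Lemma ramp_ge a b x : a < b -> (x <= a)%R%:R <= ramp a b x.
Proof.
move=> ab; have [xa|ax] := leP x a; last by have /andP[] := ramp01 a b x.
rewrite /ramp le_min lexx le_max /=; apply/orP; right.
by rewrite ler_pdivlMr ?subr_gt0// mul1r lerB.
Qed.

Lemma normal_cdfE x : Phi x = \int[mu]_y ((y <= x)%R%:R * phi y).
Proof.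
rewrite /Defs.cdf /normal_prob -[LHS]/(\int[mu]_(y in `]-oo, x]) phi y).
rewrite Rintegral_mkcond; apply: eq_Rintegral => y _.
rewrite patchE mem_setE in_itv /=.
by case: leP; rewrite ?mul1r ?mul0r.
Qed.

Lemma weighted_normal_integrable (h : R -> R) : measurable_fun setT h ->
  (forall x, 0 <= h x <= 1) ->
  mu.-integrable setT (EFin \o (fun x => h x * phi x)).
Proof.
move=> mh h01; apply: le_integrable (integrable_normal_pdf 0 1) => //.
  by apply/measurable_EFinP; apply: measurable_funM => //; exact: measurable_normal_pdf.
move=> x _ /=; have /andP[h0 h1] := h01 x.
by rewrite lee_fin normrM (ger0_norm h0) ler_piMl.
Qed.

Lemma measurable_le_indicator (a : R) :
  measurable_fun setT (fun y : R => (y <= a)%R%:R : R).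
Proof.
have -> : (fun y : R => (y <= a)%R%:R : R) = \1_(`]-oo, a]%classic).
  by apply/funext => y; rewrite indicE mem_setE in_itv.
exact: measurable_indic.
Qed.

Lemma ramp_normal_bounds a b : a < b ->
  Phi a <= \int[mu]_x (ramp a b x * phi x) <= Phi b.
Proof.
move=> ab; rewrite !normal_cdfE.
have bool01 (t : bool) : 0 <= (t%:R : R) <= 1 by case: t; rewrite lexx ler01.
have int_ind c : mu.-integrable setT (EFin \o (fun y => (y <= c)%R%:R * phi y)).
  by apply: weighted_normal_integrable => //; exact: measurable_le_indicator.
have int_ramp : mu.-integrable setT (EFin \o (fun y => ramp a b y * phi y)).
  apply: weighted_normal_integrable; last exact: ramp01.
  by apply: continuous_measurable_fun; exact: continuous_ramp.
apply/andP; split; apply: le_Rintegral => // x _.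
  by rewrite ler_wpM2r ?normal_pdf_ge0 ?ramp_ge.
by rewrite ler_wpM2r ?normal_pdf_ge0 ?ramp_le.
Qed.

(** Ramps on [[x - d, x]] and [[x, x + d]] enclose the indicator; half of [e] pays for the variation
    of [Phi] near [x], the other half for the test function error. *)
Lemma rad_cdf_normal (x : R) : Phi y @[y --> x] --> Phi x ->
  forall e : R, 0 < e -> exists V : R, forall n k (G : 'M[R]_(n, k)),
  \rank (projP G) = k -> V < k%:R * sigma2 G ->
  `|rad_cdf G x - Phi x| <= e.
Proof.
move=> cPhi e e0; have e20 : 0 < e / 2 by rewrite divr_gt0.
have [r /= r0 rP] : \forall y \near x, `|Phi x - Phi y| <= e / 2.
  by move/cvgrPdist_le : cPhi; apply.
pose d := r / 2; have d0 : 0 < d by rewrite divr_gt0.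
have [V1 V1P] := AR_test_function (@continuous_ramp (x - d) x)
  (ramp01 (x - d) x) e20.
have [V2 V2P] := AR_test_function (@continuous_ramp x (x + d))
  (ramp01 x (x + d)) e20.
exists (Num.max V1 V2) => n k G rk; rewrite gt_max => /andP[V1v V2v].
have {V1P} := V1P n k G rk V1v; have {V2P} := V2P n k G rk V2v.
have xd : x - d < x by lra.
have dx : x < x + d by lra.
have /andP[l1 _] := ramp_normal_bounds xd.
have /andP[_ u1] := ramp_normal_bounds dx.
have r1 : `|Phi x - Phi (x - d)| <= e / 2.
  by apply: rP => /=; rewrite opprB addrC subrK gtr0_norm// /d; lra.
have r2 : `|Phi x - Phi (x + d)| <= e / 2.
  apply: rP => /=; rewrite opprD addrA subrr add0r normrN gtr0_norm// /d; lra.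
have l2 : rmean (fun s => ramp (x - d) x (normalize G (ARr G s))) <= rad_cdf G x.
  by apply: ler_rmean => s; exact: ramp_le.
have u2 : rad_cdf G x <= rmean (fun s => ramp x (x + d) (normalize G (ARr G s))).
  by apply: ler_rmean => s; exact: ramp_ge.
move: r1 r2; rewrite !ler_norml => /andP[? ?] /andP[? ?] /andP[? ?] /andP[? ?].
by apply/andP; split; lra.
Qed.

End NormalLimit.

(** * Effect of sign changes of the rows of [G] *)

Section Reflection.
Variables (R : realType) (n k : nat).
Implicit Types (G : 'M[R]_(n, k)) (s : {ffun 'I_n -> bool}).

Lemma trmx_Dmat s : (Dmat R s)^T = Dmat R s.
Proof. exact: tr_diag_mx. Qed.

Lemma Dmat_sq s : Dmat R s *m Dmat R s = 1%:M.
Proof.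
rewrite mulmx_diag -diag_const_mx; congr diag_mx.
by apply/rowP => i; rewrite !mxE sgn_sq.
Qed.

(** The sign matrix is symmetric and squares to the identity, so the Gram matrix is unchanged. *)
Lemma projP_Dmat s G : projP (Dmat R s *m G) = Dmat R s *m projP G *m Dmat R s.
Proof.
rewrite /projP trmx_mul trmx_Dmat.
have -> : G^T *m Dmat R s *m (Dmat R s *m G) = G^T *m G.
  by rewrite -mulmxA (mulmxA (Dmat R s)) Dmat_sq mul1mx.
by rewrite !mulmxA.
Qed.

Lemma projP_Dmat_entry s G i j :
  projP (Dmat R s *m G) i j = sgn R (s i) * projP G i j * sgn R (s j).
Proof. by rewrite projP_Dmat mul_mx_diag mxE mul_diag_mx !mxE. Qed.

Lemma sigma2_Dmat s G : sigma2 (Dmat R s *m G) = sigma2 G.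
Proof.
congr (_ * _); apply: eq_bigr => i _; apply: eq_bigr => j _.
by rewrite projP_Dmat_entry !exprMn !expr2 !sgn_sq mul1r mulr1.
Qed.

Lemma normalize_ARstat_Dmat s G :
  normalize (Dmat R s *m G) (ARstat (Dmat R s *m G)) = normalize G (ARr G s).
Proof.
rewrite /normalize sigma2_Dmat; congr (_ * (_ - _)).
apply: eq_bigr => i _; apply: eq_bigr => j _.
by rewrite mul1r mulr1 projP_Dmat_entry.
Qed.

End Reflection.

(** * Measurability of matrix operations and of the statistic *)

Section Measurability.
Context (d : measure_display) (T : measurableType d) (R : realType).

(** Entrywise, in accordance with the generators [mx_gen] of the matrix sigma-algebra. *)
Definition mx_measurable_fun m n (M : T -> 'M[R]_(m, n)) :=
  forall i j, measurable_fun setT (fun w => M w i j).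

Lemma measurable_inv : measurable_fun setT (@GRing.inv R).
Proof.
rewrite -(setUv [set (0 : R)]); apply/measurable_funU => //.
  exact: measurableC.
split; first exact: measurable_fun_set1.
apply: open_continuous_measurable_fun.
  apply: closed_openC; apply: accessible_closed_set1.
  by apply: hausdorff_accessible; exact: Rhausdorff.
by move=> x; rewrite inE => /eqP x0; exact: inv_continuous.
Qed.

Lemma measurable_funV (f : T -> R) : measurable_fun setT f ->
  measurable_fun setT (fun w => (f w)^-1).
Proof. by move=> mf; apply: measurableT_comp mf; exact: measurable_inv. Qed.

Lemma mx_measurable_mul m n p (A : T -> 'M[R]_(m, n)) (B : T -> 'M[R]_(n, p)) :
  mx_measurable_fun A -> mx_measurable_fun B ->
  mx_measurable_fun (fun w => A w *m B w).
Proof.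
move=> mA mB i j; under eq_fun do rewrite mxE.
by apply: measurable_sum => l; apply: measurable_funM; [exact: mA|exact: mB].
Qed.

Lemma mx_measurable_tr m n (A : T -> 'M[R]_(m, n)) :
  mx_measurable_fun A -> mx_measurable_fun (fun w => (A w)^T).
Proof. by move=> mA i j; under eq_fun do rewrite mxE; exact: mA. Qed.

Lemma measurable_det n (A : T -> 'M[R]_n) :
  mx_measurable_fun A -> measurable_fun setT (fun w => \det (A w)).
Proof.
move=> mA; apply: measurable_sum => s; apply: measurable_funM => //.
by apply: measurable_prod => i _; exact: mA.
Qed.

Lemma mx_measurable_adj n (A : T -> 'M[R]_n) :
  mx_measurable_fun A -> mx_measurable_fun (fun w => \adj (A w)).
Proof.
move=> mA i j; under eq_fun do rewrite mxE.
apply: measurable_funM => //; apply: measurable_det => i' j'.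
by under eq_fun do rewrite !mxE; exact: mA.
Qed.

Lemma mx_measurable_invmx n (A : T -> 'M[R]_n) :
  mx_measurable_fun A -> mx_measurable_fun (fun w => invmx (A w)).
Proof.
move=> mA i j.
(* Cramer's formula where the determinant is nonzero; elsewhere [invmx] returns its argument. *)
have -> : (fun w => invmx (A w) i j) =
    (fun w => if \det (A w) == 0 then A w i j
              else (\det (A w))^-1 * (\adj (A w)) i j).
  by apply/funext => w; rewrite /invmx unitmxE unitfE; case: eqP => //= _; rewrite mxE.
apply: measurable_fun_ifT; last 2 first.
- exact: mA.
- apply: measurable_funM; last exact: mx_measurable_adj.
  by apply: measurable_funV; exact: measurable_det.
by apply: measurable_fun_eqr => //; exact: measurable_det.
Qed.

Lemma mx_measurable_projP n k (M : T -> 'M[R]_(n, k)) :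
  mx_measurable_fun M -> mx_measurable_fun (fun w => projP (M w)).
Proof.
move=> mM; apply: mx_measurable_mul; last exact: mx_measurable_tr.
apply: mx_measurable_mul => //; apply: mx_measurable_invmx.
by apply: mx_measurable_mul => //; exact: mx_measurable_tr.
Qed.

Lemma measurable_normalize_ARstat n k (M : T -> 'M[R]_(n, k)) :
  mx_measurable_fun M ->
  measurable_fun setT (fun w => normalize (M w) (ARstat (M w))).
Proof.
move=> /mx_measurable_projP mP; apply: measurable_funM.
  apply: measurable_funV; apply: measurableT_comp.
    by apply: continuous_measurable_fun; exact: sqrt_continuous.
  apply: measurable_funM => //; apply: measurable_funM => //.
  apply: measurable_sum => i.
  under eq_fun do rewrite big_mkcond.
  apply: measurable_sum => j; case: (i != j) => //.
  by apply: measurable_funX; exact: mP.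
apply: measurable_funB => //; apply: measurable_sum => i.
apply: measurable_sum => j; apply: measurable_funM => //.
by apply: measurable_funM => //; exact: mP.
Qed.

End Measurability.

(** * The law of the statistic as a mixture of conditional laws *)

Section RandomMatrix.
Context (R : realType) (d : measure_display) (T : measurableType d).

Lemma mx_measurable_ARstat_le n k (x : R) :
  mx_measurable [set M : 'M[R]_(n, k) | normalize M (ARstat M) <= x].
Proof.
(* Applying the measurability results to the identity of the matrix space itself yields an event in
   that space. *)
have mid : mx_measurable_fun
    (fun M : g_sigma_algebraType (@mx_gen R n k) => M : 'M[R]_(n, k)).
  by move=> i j _ B mB; rewrite setTI; apply: sub_sigma_algebra; exists i, j, B.
have := measurable_normalize_ARstat mid measurableT (measurable_itv `]-oo, x]).
by rewrite setTI.
Qed.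

Lemma measurable_rad_cdf n k (M : T -> 'M[R]_(n, k)) (x : R) :
  mx_measurable_fun M -> measurable_fun setT (fun w => rad_cdf (M w) x).
Proof.
move=> mM; apply: measurable_funM => //; apply: measurable_sum => s.
have mX : measurable_fun setT (fun w => normalize (M w) (ARr (M w) s)).
  under eq_fun do rewrite -normalize_ARstat_Dmat.
  by apply: measurable_normalize_ARstat; apply: mx_measurable_mul.
exact: measurableT_comp (measurable_le_indicator x) mX.
Qed.

Lemma rad_cdf_ge0 n k (G : 'M[R]_(n, k)) x : 0 <= rad_cdf G x.
Proof. by apply: rmean_ge0 => s. Qed.

Lemma rad_cdf_le1 n k (G : 'M[R]_(n, k)) x : rad_cdf G x <= 1.
Proof.
rewrite -[leRHS](@rmean_cst R n); apply: ler_rmean => s.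
by rewrite lern1 leq_b1.
Qed.

(** Invariance replaces the event by its average over sign matrices, each of which turns [ARstat]
    into [ARr]; the finite average then moves inside the integral. *)
Lemma reflection_invariant_AR (P : probability T R) n k (M : T -> 'M[R]_(n, k)) x :
  mx_measurable_fun M ->
  (forall A : set 'M[R]_(n, k), mx_measurable A ->
    P (M @^-1` A) = (((2 ^+ n)^-1)%:E * \sum_(s : {ffun 'I_n -> bool})
      P ((fun w => Dmat R s *m M w) @^-1` A))%E) ->
  P [set w | normalize (M w) (ARstat (M w)) <= x] =
    (\int[P]_w (rad_cdf (M w) x)%:E)%E.
Proof.
move=> mM Mrefl; rewrite (Mrefl _ (@mx_measurable_ARstat_le n k x)).
pose ind (s : {ffun 'I_n -> bool}) w : R :=
  (normalize (M w) (ARr (M w) s) <= x)%R%:R.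
pose E (s : {ffun 'I_n -> bool}) := [set w | normalize (M w) (ARr (M w) s) <= x].
have mE s : measurable (E s).
  have mD : mx_measurable_fun (fun w => Dmat R s *m M w) by apply: mx_measurable_mul.
  have := measurable_normalize_ARstat mD measurableT (measurable_itv `]-oo, x]).
  rewrite setTI; congr (measurable _); apply/seteqP.
  by split=> w /=; rewrite in_itv /= normalize_ARstat_Dmat.
have indE s w : ind s w = \1_(E s) w.
  rewrite indicE /ind; congr (nat_of_bool _)%:R.
  by apply/idP/idP; rewrite inE.
under [RHS]eq_integral do rewrite /rad_cdf EFinM -sumEFin.
have mind s : measurable_fun setT (fun w => (ind s w)%:E).
  by under eq_fun do rewrite indE; apply/measurable_EFinP; exact: measurable_indic.
have msum : measurable_fun setT (fun w => \sum_s (ind s w)%:E)%E.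
  by apply: emeasurable_sum => s; exact: mind.
have c0 : (0 <= ((2 ^+ n)^-1)%:E :> \bar R)%E.
  by rewrite lee_fin invr_ge0 exprn_ge0.
rewrite ge0_integralZl//; last by move=> w _; apply: sume_ge0.
rewrite ge0_integral_sum//.
congr (_ * _)%E; apply: eq_bigr => s _.
have -> : (fun w => Dmat R s *m M w) @^-1`
    [set M | normalize M (ARstat M) <= x] = E s.
  by apply/seteqP; split => w /=; rewrite normalize_ARstat_Dmat.
rewrite -[in LHS](setIT (E s)) -integral_indic//.
by apply: eq_integral => w _; rewrite -indE.
Qed.

End RandomMatrix.

(** * Conditional and unconditional convergence to the normal law *)

Theorem theorem1 (R : realType) (d : measure_display) (T : measurableType d)
  (P : probability T R) (dX : measure_display) (X : measurableType dX)
  (kn : nat -> nat) (W : forall n, 'I_n -> T -> X)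
  (g : forall n, 'I_(kn n) -> X -> R)
  (HWmeas : forall n (i : 'I_n), measurable_fun setT (W n i))
  (Hgmeas : forall n (j : 'I_(kn n)), measurable_fun setT (g n j))
  (Hindep : forall n, mutually_independent P (W n))
  (Hint : forall n (i : 'I_n) (j : 'I_(kn n)),
      P.-integrable setT (EFin \o (g n j \o W n i)))
  (Hmean : forall n (i : 'I_n) (j : 'I_(kn n)), ('E_P[g n j \o W n i] = 0)%E)
  (Hrefl : forall n (A : set 'M[R]_(n, kn n)), mx_measurable A ->
      P (Gmat W g n @^-1` A) =
        (((2 ^+ n)^-1)%:E *
         \sum_(s : {ffun 'I_n -> bool})
            P ((fun w => @Dmat R n s *m Gmat W g n w) @^-1` A))%E)
  (Hab : exists C : R, 0 < C /\
      {ae P, forall w, \forall n \near \oo,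
          \rank (projP (Gmat W g n w)) = kn n /\
          C^-1 < sigma2 (Gmat W g n w)})
  (Hk : ((kn n)%:R : R) @[n --> \oo] --> +oo) :
  {ae P, forall w,
      conv_in_dist (fun n x => rad_cdf (Gmat W g n w) x) (normal_prob 0 1)}
  /\
  conv_in_dist
    (fun n x => fine (P [set w | normalize (Gmat W g n w)
                                   (ARstat (Gmat W g n w)) <= x]))
    (normal_prob 0 1).
Proof.
have mG n : mx_measurable_fun (Gmat W g n).
  move=> i j; under eq_fun do rewrite mxE.
  by apply: measurableT_comp.
have cvg_cond : {ae P, forall w,
    conv_in_dist (fun n x => rad_cdf (Gmat W g n w) x) (normal_prob 0 1)}.
  have [C [C0 HC]] := Hab; apply: filterS HC => w Hw x cx.
  apply/cvgrPdist_le => e e0; have [V VP] := rad_cdf_normal cx e0.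
  near=> n.
  have [rk sC] : \rank (projP (Gmat W g n w)) = kn n /\
      C^-1 < sigma2 (Gmat W g n w) by near: n.
  rewrite distrC; apply: VP => //.
  (* With [C^-1 < sigma2], this pushes [k * sigma2] beyond [V]; the extra 1 gives strictness and
     [k > 0]. *)
  have kV : `|V| * C + 1 <= (kn n)%:R.
    by near: n; move/cvgryPge : Hk; apply.
  apply: (@le_lt_trans _ _ `|V|); first exact: ler_norm.
  have k0 : 0 < (kn n)%:R :> R by apply: lt_le_trans kV; rewrite ltr_wpDl// mulr_ge0// ltW.
  apply: (@lt_trans _ _ ((kn n)%:R * C^-1)); last by rewrite ltr_pM2l.
  by rewrite ltr_pdivlMr//; lra.
split=> // x cx.
under eq_fun do rewrite (reflection_invariant_AR x (mG _) (Hrefl _)).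
pose Phi_x := Defs.cdf (@normal_prob R 0 1) x.
(* The conditional distribution functions converge almost surely to a constant and are bounded by 1,
   so their integrals converge to it. *)
have [|||||_ _] := @dominated_convergence _ _ _ P setT measurableT
  (fun n w => (rad_cdf (Gmat W g n w) x)%:E) (cst Phi_x%:E) (cst 1%E).
- by move=> n; apply/measurable_EFinP; exact: measurable_rad_cdf.
- exact: measurable_cst.
- apply: filterS cvg_cond => w Hw _; apply: cvg_EFin; last exact: Hw.
  by apply: nearW.
- exact: finite_measure_integrable_cst.
- apply: aeW => w n _ /=.
  by rewrite lee_fin ger0_norm ?rad_cdf_le1 ?rad_cdf_ge0.
have P1 : (P setT = 1)%E by exact: probability_setT.
by rewrite integral_cst// [X in (_ * X)%E]P1 mule1 => /fine_cvg.
Unshelve. all: by end_near.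
Qed.
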